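(* Let $R$ be a commutative ring, let $\underline{x} = x_1,\ldots,x_k$ be an ordered sequence of elements of $R$, and let $M$ be an $R$-module. For $\underline{n}=(n_1,\ldots,n_k)\in(\mathbb{N}_+)^k$ write $\underline{x}^{(\underline{n})} = x_1^{n_1},\ldots,x_k^{n_k}$. The following conditions are equivalent. (i) The sequence $\underline{x}$ is $M$-proregular. (ii) There is an $\underline{n}\in(\mathbb{N}_+)^k$ such that the sequence $\underline{x}^{(\underline{n})}$ is $M$-proregular. (iii) The sequence $\underline{x}^{(\underline{n})}$ is $M$-proregular for all $\underline{n}\in(\mathbb{N}_+)^k$.
   Context: $\mathbb{N}_+$ denotes the set of positive integers. Proregular: a sequence $x_1,\ldots,x_k$ in $R$ is called $M$-proregular if for every $i=1,\ldots,k$ and every positive integer $n$ there is an integer $m\ge n$ such that the map $$(x_1^m,\ldots,x_{i-1}^m)M :_M x_i^m/(x_1^m,\ldots,x_{i-1}^m)M \xrightarrow{\ x_i^{m-n}\ } (x_1^n,\ldots,x_{i-1}^n)M :_M x_i^n/(x_1^n,\ldots,x_{i-1}^n)M$$ induced by multiplication by $x_i^{m-n}$ is zero; equivalently $(x_1^m,\ldots,x_{i-1}^m)M :_M x_i^m \subseteq (x_1^n,\ldots,x_{i-1}^n)M :_M x_i^{m-n}$. Here $N:_M y = \{u\in M : yu\in N\}$; for $i=1$ the submodule $(x_1^m,\ldots,x_{i-1}^m)M$ is $0$. *)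

(* Defs.v *)
From mathcomp Require Import all_boot all_algebra.

Set Implicit Arguments.
Unset Strict Implicit.
Unset Printing Implicit Defensive.

Import GRing.Theory.
Local Open Scope ring_scope.

(* Submodules of M are represented by their membership predicates M -> Prop.
   Sequences x_1, ..., x_k are functions on 'I_k, so the index i of the
   literature corresponds to the ordinal i - 1. *)

(* The submodule (x_j : j < i)M of M: since R is commutative, the product of
   the ideal generated by the x_j with M is the set of sums of the x_j v_j. *)
Definition initial_submod (R : comPzRingType) (M : lmodType R) (k : nat)
    (x : 'I_k -> R) (i : nat) (u : M) : Prop :=
  exists v : 'I_k -> M, u = \sum_(j < k | (j < i)%N) x j *: v j.

(* N :_M y *)
Definition colon (R : comPzRingType) (M : lmodType R) (N : M -> Prop) (y : R)
    (u : M) : Prop :=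
  N (y *: u).

Definition seq_pow (R : comPzRingType) (k : nat) (x : 'I_k -> R)
    (n : 'I_k -> nat) : 'I_k -> R :=
  fun i => x i ^+ n i.

(* The inclusion says exactly that multiplication by x_i ^ (m - n) induces the
   zero map
     ((x_j ^ m : j < i)M : x_i ^ m) / (x_j ^ m : j < i)M
       -> ((x_j ^ n : j < i)M : x_i ^ n) / (x_j ^ n : j < i)M,
   i.e. that x_i ^ (m - n) sends the first colon module into
   (x_j ^ n : j < i)M. *)
Definition proregular (R : comPzRingType) (M : lmodType R) (k : nat)
    (x : 'I_k -> R) : Prop :=
  forall (i : 'I_k) (n : nat), (0 < n)%N ->
  exists2 m : nat, (n <= m)%N &
    forall u : M,
      colon (initial_submod (seq_pow x (fun=> m)) i) (x i ^+ m) u ->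
      colon (initial_submod (seq_pow x (fun=> n)) i) (x i ^+ (m - n)) u.

Arguments proregular {R} M {k} x.

(* Main.v *)
(** Call [(a, b)] good for [i] if multiplication by [x_i ^ (b_i - a_i)] induces
    the zero map from the [b]-th to the [a]-th colon module, for exponent
    vectors [a <= b].  Good pairs stay good when [a] decreases and [b]
    increases.  Proregularity of [x^(n)] asks for good pairs [(p n, q n)] with
    [q >= p] for each [p]; as the multiples of any positive vector are cofinal
    among all exponent vectors, this does not depend on [n]. *)

Require Import Defs.
From mathcomp Require Import all_boot all_algebra.

Import GRing.Theory.
Local Open Scope ring_scope.

Section Proregular.

Context {R : comPzRingType} {M : lmodType R} {k : nat}.
Implicit Types (x y : 'I_k -> R) (a b n : 'I_k -> nat).

Lemma initial_submodZ x i c (u : M) :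
  initial_submod x i u -> initial_submod x i (c *: u).
Proof.
case=> v ->; exists (fun j => c *: v j).
by rewrite scaler_sumr; apply: eq_bigr => j _; rewrite !scalerA mulrC.
Qed.

Lemma initial_submod_expW x a b i (u : M) : (forall j, a j <= b j)%N ->
  initial_submod (seq_pow x b) i u -> initial_submod (seq_pow x a) i u.
Proof.
move=> le_ab [v ->]; exists (fun j => x j ^+ (b j - a j) *: v j).
by apply: eq_bigr => j _; rewrite scalerA /seq_pow -exprD subnKC.
Qed.

Lemma eq_initial_submod x y i (u : M) : x =1 y ->
  initial_submod x i u -> initial_submod y i u.
Proof.
by move=> eq_xy [v ->]; exists v; apply: eq_bigr => j _; rewrite eq_xy.
Qed.

Definition colon_map_zero x (i : 'I_k) a b : Prop := forall u : M,
  colon (initial_submod (seq_pow x b) i) (x i ^+ b i) u ->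
  colon (initial_submod (seq_pow x a) i) (x i ^+ (b i - a i)) u.

(** If [u] lies in the [b']-th colon module, then [x_i ^ (b'_i - b_i) u] lies in the [b]-th one. The
    zero map applies to it, and a further factor [x_i ^ (a_i - a'_i)] brings the total exponent to
    [b'_i - a'_i]. *)
Lemma colon_map_zeroW x i a a' b b' :
    (forall j, a' j <= a j)%N -> (a i <= b i)%N -> (forall j, b j <= b' j)%N ->
  colon_map_zero x i a b -> colon_map_zero x i a' b'.
Proof.
move=> le_a le_ab le_b zero_ab u ub'; rewrite /colon.
have ub : colon (initial_submod (seq_pow x b) i) (x i ^+ b i)
            (x i ^+ (b' i - b i) *: u).
  rewrite /colon scalerA -exprD subnKC //.
  exact: initial_submod_expW le_b ub'.
have /(initial_submodZ _ _ (x i ^+ (a i - a' i))) := zero_ab _ ub.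
rewrite !scalerA -!exprD => /(initial_submod_expW _ _ _ _ _ le_a).
rewrite [(b i - _ + _)%N]addnC addnBA // subnK //.
by rewrite addnC addnBA // subnK // (leq_trans le_ab).
Qed.

(** Since [(x_j ^ n_j) ^ p = x_j ^ (n_j p)], constant powers of [seq_pow x n] are powers of [x]
    along multiples of [n]. *)
Lemma proregular_seq_powP x n :
  proregular M (seq_pow x n) <->
  forall (i : 'I_k) (p : nat), (0 < p)%N -> exists2 q, (p <= q)%N &
    colon_map_zero x i (fun j => n j * p)%N (fun j => n j * q)%N.
Proof.
have powE m : seq_pow (seq_pow x n) (fun=> m) =1 seq_pow x (fun j => n j * m)%N.
  by move=> j; rewrite /seq_pow exprM.
split=> reg i p p_gt0; have [q le_pq zero_pq] := reg i p p_gt0; exists q => // u.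
- rewrite /colon -mulnBr !exprM => /(eq_initial_submod _ _ _ _ (fsym (powE q))).
  by move/zero_pq; apply: eq_initial_submod (powE p).
- move/(eq_initial_submod _ _ _ _ (powE q)); rewrite /= -exprM => /zero_pq.
  rewrite /colon -mulnBr exprM.
  exact: eq_initial_submod (fsym (powE p)).
Qed.

Lemma proregular_seq_pow_indep x n n' :
    (forall i, 0 < n i)%N -> (forall i, 0 < n' i)%N ->
  proregular M (seq_pow x n) -> proregular M (seq_pow x n').
Proof.
move=> n_gt0 n'_gt0 /proregular_seq_powP reg; apply/proregular_seq_powP.
(* As [n j >= 1], this choice gives [n' j * p <= n j * N] for all [j]. *)
move=> i p p_gt0; pose N := ((\max_j n' j) * p)%N.
have N_gt0 : (0 < N)%N.
  by rewrite muln_gt0 p_gt0 andbT (leq_trans (n'_gt0 i)) // leq_bigmax.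
have [m le_Nm zero_Nm] := reg i N N_gt0.
(* As [n' j >= 1], the second argument makes the witness [q] satisfy [n j * m <= n' j * q]; the
   first secures [p <= q]. *)
exists (maxn p ((\max_j n j) * m)); first exact: leq_maxl.
apply: colon_map_zeroW zero_Nm => [j||j].
- apply: (@leq_trans N); last by rewrite leq_pmull.
  by rewrite leq_mul2r leq_bigmax orbT.
- by rewrite leq_mul2l le_Nm orbT.
- apply: (@leq_trans ((\max_j n j) * m)); first by rewrite leq_mul2r leq_bigmax orbT.
  by rewrite (leq_trans (leq_maxr p _)) // leq_pmull.
Qed.

End Proregular.

Local Close Scope ring_scope.

Theorem corollary0p2 (R : comPzRingType) (M : lmodType R) (k : nat)
    (x : 'I_k -> R) :
  [<-> (* (i) *)
       proregular M x;
       (* (ii) *)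
       exists n : 'I_k -> nat,
         (forall i, 0 < n i) /\ proregular M (seq_pow x n);
       (* (iii) *)
       forall n : 'I_k -> nat,
         (forall i, 0 < n i) -> proregular M (seq_pow x n)].
Proof.
tfae.
(* [x i ^+ 1] reduces to [x i], so [seq_pow x (fun=> 1)] is convertible to [x]. *)
- by move=> reg; exists (fun=> 1).
- by move=> [n [n_gt0 reg]] n' n'_gt0; apply: proregular_seq_pow_indep reg.
- by move=> /(_ (fun=> 1)); apply.
Qed.
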